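(* Let $f:\mathbb{R}^n\to\mathbb{R}$ be an $L$-smooth convex function ($L>0$) with a global minimizer $x^*$, let $\varphi:\mathbb{R}^n\to\mathbb{R}$ be $\sigma$-strongly convex ($\sigma>0$), let $z^*\in\mathbb{R}^n$ satisfy $\nabla\varphi^*(z^* )=x^*$, and let $0<s\le\frac1L$. Let $\{x_k\}_{k\ge0},\{z_k\}_{k\ge0}\subset\mathbb{R}^n$ be sequences satisfying, for all $k\ge0$, $$z_{k+1}-z_k=-\sigma s\frac{k+1}{2}\nabla f(x_k),\qquad (k+3)x_{k+1}=2\nabla\varphi^*(z_{k+1})+(k+1)[x_k-s\nabla f(x_k)].$$ Then for all $k\ge0$ $$f(x_k)-f(x^* )\le\frac{2\sigma s[f(x_0)-f(x^* )]+4D_{\varphi^*}(z_1,z^* )}{(k+1)(k+2)\sigma s},$$ and, as $k\to\infty$, $$\min_{0\le i\le k}\|\nabla f(x_i)\|_2^2=o\left(\frac{1}{k^3}\right).$$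
   Context: $\mathbb{R}^n$ carries the Euclidean inner product $\langle\cdot,\cdot\rangle$ and norm $\|\cdot\|_2$ and is identified with its dual. $f$ is $L$-smooth convex if it is convex, differentiable and $\nabla f$ is $L$-Lipschitz. $\varphi$ is $\sigma$-strongly convex if it is convex and $\varphi(y)-\varphi(x)-\langle g,y-x\rangle\ge\frac{\sigma}{2}\|y-x\|_2^2$ for all $x,y$ and $g\in\partial\varphi(x)$. The conjugate is $\varphi^*(z)=\sup_x\{\langle z,x\rangle-\varphi(x)\}$, which is finite and differentiable. The Bregman divergence of $\varphi^*$ is $D_{\varphi^*}(z,w)=\varphi^*(z)-\varphi^*(w)-\langle z-w,\nabla\varphi^*(w)\rangle$. *)

(* Defs.v *)
From HB Require Import structures.
From mathcomp Require Import all_boot all_order all_algebra.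
From mathcomp Require Import all_classical all_reals all_analysis.

Set Implicit Arguments.
Unset Strict Implicit.
Unset Printing Implicit Defensive.

Import Order.TTheory GRing.Theory Num.Theory.
Import numFieldNormedType.Exports.

Local Open Scope classical_set_scope.
Local Open Scope ring_scope.

(* The library norm `|u| on 'rV[R]_n is the sup norm; it enters only through
   [differentiable] and ['d], which are the same for any equivalent norm. *)

Section Euclidean.
Context {R : realType} {n : nat}.
Implicit Types (u v x y z w g : 'rV[R]_n) (f phi : 'rV[R]_n -> R).

Definition dot u v : R := \sum_(i < n) u 0 i * v 0 i.

Definition norm2 u : R := Num.sqrt (dot u u).

(* The Riesz representative of the Frechet differential, see [gradientE]; junk
   where f is not differentiable. *)
Definition gradient f x : 'rV[R]_n := \row_(i < n) 'd f x (delta_mx 0 i).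

Lemma gradientE f x v : 'd f x v = dot (gradient f x) v.
Proof.
rewrite {1}[v]row_sum_delta linear_sum; apply: eq_bigr => i _ /=.
by rewrite linearZ mxE mulrC.
Qed.

Definition convex f : Prop :=
  convex_function [set: convex_lmodType 'rV[R]_n] f.

Definition smooth_convex (L : R) f : Prop :=
  [/\ convex f,
      forall x, differentiable f x
    & forall x y, norm2 (gradient f x - gradient f y) <= L * norm2 (x - y)].

Definition subdifferential phi x : set 'rV[R]_n :=
  [set g | forall y, phi x + dot g (y - x) <= phi y].

Definition strongly_convex (sigma : R) phi : Prop :=
  convex phi /\
  forall x y g, subdifferential phi x g ->
    sigma / 2 * norm2 (y - x) ^+ 2 <= phi y - phi x - dot g (y - x).

(* The supremum is taken in the extended reals; [conjugate] is its real value,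
   since only conjugates that are everywhere finite are considered. *)
Definition econjugate phi z : \bar R :=
  ereal_sup [set (dot z x - phi x)%:E | x in [set: 'rV[R]_n]].

Definition conjugate phi z : R := fine (econjugate phi z).

Definition bregman (psi : 'rV[R]_n -> R) z w : R :=
  psi z - psi w - dot (z - w) (gradient psi w).

End Euclidean.

(* Main.v *)
(* With psi the conjugate of phi, the energy
     E_k = (k+1)(k+2) sigma s (f x_k - f x^* ) + 4 D_psi(z_{k+1}, z^* )
   is nonnegative and satisfies
     E_{k+1} + sigma s^2 (k+2)/2 ((k+1) |g_k|^2 + |g_{k+1}|^2) <= E_k,
   where g_k is the gradient of f at x_k.  Monotonicity gives the rate for f;
   since E converges, its drop between k/2 and k, which dominates k^3 times the
   smallest squared gradient, tends to 0.

   The decrease combines cocoercivity of the gradient of f, used towards x^* and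
   towards x_k, with the quadratic upper bound on psi.  The latter needs every z
   to be a subgradient of phi somewhere: a first subgradient is found at an
   interior minimiser of phi + K |.|^2 on a ball, strong convexity then makes
   phi - <z, .> coercive, and a minimiser of it is the gradient of psi at z. *)
Require Import Defs.
From HB Require Import structures.
From mathcomp Require Import all_boot all_order all_algebra.
From mathcomp Require Import all_classical all_reals all_analysis.
From mathcomp Require Import ring lra zify.

Import Order.TTheory GRing.Theory Num.Theory.
Import numFieldNormedType.Exports.

Local Open Scope classical_set_scope.
Local Open Scope ring_scope.

(** * The Euclidean inner product and its comparison with the sup norm *)

Section dot_theory.
Context {R : realType} {n : nat}.
Implicit Types (u v w : 'rV[R]_n) (c : R).

Lemma dotC u v : dot u v = dot v u.
Proof. by apply: eq_bigr => i _; rewrite mulrC. Qed.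

Lemma dotDl u v w : dot (u + v) w = dot u w + dot v w.
Proof. by rewrite -big_split; apply: eq_bigr => i _; rewrite mxE mulrDl. Qed.

Lemma dotZl c u v : dot (c *: u) v = c * dot u v.
Proof. by rewrite mulr_sumr; apply: eq_bigr => i _; rewrite mxE mulrA. Qed.

Lemma dotNl u v : dot (- u) v = - dot u v.
Proof. by rewrite -scaleN1r dotZl mulN1r. Qed.

Lemma dotDr u v w : dot u (v + w) = dot u v + dot u w.
Proof. by rewrite !(dotC u) dotDl. Qed.

Lemma dotZr c u v : dot u (c *: v) = c * dot u v.
Proof. by rewrite !(dotC u) dotZl. Qed.

Lemma dotNr u v : dot u (- v) = - dot u v.
Proof. by rewrite !(dotC u) dotNl. Qed.

Definition dotE := (dotDl, dotDr, dotNl, dotNr, dotZl, dotZr).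

Lemma dot_ge0 u : 0 <= dot u u.
Proof. by apply: sumr_ge0 => i _; rewrite -expr2 sqr_ge0. Qed.

Lemma norm2_sqr u : norm2 u ^+ 2 = dot u u.
Proof. by rewrite sqr_sqrtr ?dot_ge0. Qed.

Lemma norm2_ge0 u : 0 <= norm2 u.
Proof. exact: sqrtr_ge0. Qed.

(** Cauchy-Schwarz without square roots: expanding [0 <= |u - c v|^2] bounds [2 c <u, v>] by
    [|u|^2 + c^2 |v|^2]. *)
Lemma dot_le_of_sqr c u v :
  0 < c -> dot u u <= c ^+ 2 * dot v v -> dot u v <= c * dot v v.
Proof.
move=> c0 uv; have := dot_ge0 (u - c *: v).
rewrite !dotE (dotC v u) => h.
rewrite -(ler_pM2l c0); nra.
Qed.

Lemma normr_coord_le u i : `|u 0 i| <= `|u|.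
Proof.
rewrite [leRHS]/Num.norm /= mx_normrE.
by apply/bigmax_geP; right; exists (0, i).
Qed.

Lemma normr_sqr_le_dot u : `|u| ^+ 2 <= dot u u.
Proof.
have [->|u0] := eqVneq u 0; first by rewrite normr0 expr0n dot_ge0.
have [|[i j] /= uE] := @mx_norm_neq0 R _ _ u; first by rewrite -normr_eq0 in u0.
rewrite [`|u|]uE (ord1 i) real_normK ?num_real // /dot (bigD1 j) //= expr2.
by rewrite lerDl sumr_ge0 // => k _; rewrite -expr2 sqr_ge0.
Qed.

Lemma dot_le_normr_sqr u : dot u u <= n%:R * `|u| ^+ 2.
Proof.
rewrite -[X in X%:R]card_ord mulr_natl -sumr_const; apply: ler_sum => i _.
by rewrite -expr2 -real_normK ?num_real // ler_sqr ?nnegrE // normr_coord_le.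
Qed.

Lemma continuous_dot (F G : 'rV[R]_n -> 'rV[R]_n) :
  continuous F -> continuous G -> continuous (fun u => dot (F u) (G u)).
Proof.
move=> cF cG; rewrite /dot.
have coordc (H : 'rV[R]_n -> 'rV[R]_n) i : continuous H ->
    continuous (fun u : 'rV[R]_n => H u 0 i : R).
  move=> cH u; apply: (@continuous_comp _ _ _ H (fun v : 'rV[R]_n => v 0 i : R)).
    exact: cH.
  exact: coord_continuous.
apply: (@continuous_big R 'I_n +%R 0 xpredT _ _ _ (fun i u => F u 0 i * G u 0 i)).
  by move=> [a b]; apply: cvgD; [exact: cvg_fst|exact: cvg_snd].
by move=> i _ u; exact: (cvgM (coordc F i cF u) (coordc G i cG u)).
Qed.

End dot_theory.

(** * First-order expansions and the gradient inequality *)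

Section gradient_theory.
Context {R : realType} {n : nat}.
Implicit Types (f phi : 'rV[R]_n -> R) (x y g : 'rV[R]_n).

Lemma convex_le f x y (t : R) : convex f -> 0 <= t <= 1 ->
  f (t *: x + (1 - t) *: y) <= t * f x + (1 - t) * f y.
Proof. by move=> cf /andP[t0 t1]; apply: (cf (Itv01 t0 t1)); rewrite inE. Qed.

Lemma gradient_littleo f x (e : R) : differentiable f x -> 0 < e ->
  \forall h \near (0 : 'rV[R]_n),
    `|f (h + x) - f x - dot (gradient f x) h| <= e * `|h|.
Proof.
move=> /diff_locally /eqaddoP dfE e0; apply: filterS (dfE e e0) => h.
by rewrite -gradientE opprD addrA.
Qed.

(** A quadratic error is [o(|h|)], so [g] represents the differential. Differentiability is not
    assumed, which lets the lemma apply to the conjugate. *)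
Lemma gradient_unique f x g (C : R) :
  (forall y, `|f y - f x - dot g (y - x)| <= C * dot (y - x) (y - x)) ->
  gradient f x = g.
Proof.
move=> fC; pose df (v : 'rV[R]_n) : R := dot g v.
have df_lin : linear df by move=> a u v; rewrite /df !dotE.
pose df' := GRing.isLinear.Build R 'rV[R]_n R _ df df_lin.
pose dfL : {linear 'rV[R]_n -> R} := HB.pack df df'.
have dfx : 'd f x = dfL :> ('rV[R]_n -> R).
  apply: diff_unique.
    apply: (@continuous_dot R n (fun=> g) id); last by move=> u; exact: cvg_id.
    by move=> u; apply: cst_continuous.
  apply/eqaddoP => e e0.
  (* [|C| n |h|^2] bounds the error in the sup norm and is at most [e |h|] once [K |h| < e]; the
     [+ 1] keeps [K] positive. *)
  pose K : R := `|C| * n%:R + 1.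
  have K0 : 0 < K by rewrite ltr_wpDl // mulr_ge0.
  apply/nbhs_ballP; exists (e / K); first by rewrite /= divr_gt0.
  move=> h; rewrite -ball_normE /= sub0r normrN ltr_pdivlMr // => hlt.
  rewrite !fctE /= opprD addrA; apply: le_trans (_ : `|C| * dot h h <= _).
    have := fC (h + x); rewrite addrK => /le_trans; apply.
    by rewrite ler_wpM2r ?dot_ge0 // ler_norm.
  have := dot_le_normr_sqr h; have := normr_ge0 h; have := normr_ge0 C.
  move: hlt; rewrite /K.
  move: (dot h h) `|h| `|C| (n%:R : R) => D H c N hlt c0 H0 DH.
  apply: (@le_trans _ _ (c * (N * H ^+ 2))); first by rewrite ler_wpM2l.
  nra.
apply/rowP => i; rewrite mxE dfx /= /df /dot (bigD1 i) //= big1.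
  by rewrite mxE !eqxx mulr1 addr0.
by move=> j /negPf ji; rewrite mxE ji andbF mulr0.
Qed.

Lemma exists_lt2 (a b : R) : 0 < a -> 0 < b -> exists t, [/\ 0 < t, t < a & t < b].
Proof.
move=> a0 b0; exists (Num.min a b / 2).
have m0 : 0 < Num.min a b by rewrite lt_min a0.
have [ma mb] : Num.min a b <= a /\ Num.min a b <= b.
  by split; rewrite ge_min lexx ?orbT.
by split; lra.
Qed.

Lemma le0_of_le_small (X c d : R) : 0 < d ->
  (forall t, 0 < t < d -> X <= c * t) -> X <= 0.
Proof.
move=> d0 Xc; rewrite leNgt; apply/negP => X0.
have c0 : 0 < `|c| + 1 by rewrite ltr_wpDl.
have [t [t0 td]] := exists_lt2 _ _ d0 (divr_gt0 X0 c0).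
rewrite ltr_pdivlMr // => tX.
have := Xc t; rewrite t0 td => /(_ isT).
by have := ler_norm c; nra.
Qed.

Lemma le0_of_le_invS (X c : R) :
  (forall N, X <= c * N.+1%:R^-1) -> X <= 0.
Proof.
move=> Xc; rewrite leNgt; apply/negP => X0.
have := truncnS_gt (c / X); set N := Num.truncn _; rewrite ltr_pdivrMr //.
by rewrite ltNge mulrC -ler_pdivlMr // Xc.
Qed.

(** Compare the chord bound at [x + t d] with the first-order expansion there, then divide by [t].
    The tolerance [e / (|d| + 1)] makes the expansion error at most [t e], even when [d = 0]. *)
Lemma convex_ge_gradient f x y : convex f -> differentiable f x ->
  f x + dot (gradient f x) (y - x) <= f y.
Proof.
move=> cf df; rewrite -subr_le0; apply/ler_addgt0Pl => e e0; rewrite addr0.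
set d := y - x.
have d0 : 0 < `|d| + 1 by rewrite ltr_wpDl.
have /nbhs_ballP[r /= r0 rP] := gradient_littleo _ _ _ df (divr_gt0 e0 d0).
have [t [t0 /ltW t1]] := exists_lt2 _ _ (@ltr01 R) (divr_gt0 r0 d0).
rewrite ltr_pdivlMr // => tr.
have nt : `|t *: d| = t * `|d| by rewrite normrZ gtr0_norm.
have /rP : ball 0 r (t *: d).
  rewrite -ball_normE /= sub0r normrN nt.
  by apply: le_lt_trans tr; rewrite ler_pM2l // lerDl.
rewrite /= ler_norml => /andP[h _].
have := convex_le f y x t cf; rewrite (ltW t0) t1 => /(_ isT).
have -> : t *: y + (1 - t) *: x = t *: d + x.
  by rewrite /d scalerBr scalerBl scale1r addrA addrAC.
move: h; rewrite dotZr nt => h1 h2.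
rewrite -(ler_pM2l t0).
have : e / (`|d| + 1) * (t * `|d|) <= t * e.
  have -> : e / (`|d| + 1) * (t * `|d|) = t * e * (`|d| / (`|d| + 1)) by ring.
  rewrite ler_piMr ?mulr_ge0 ?ltW // ltr_pdivrMr // mul1r; lra.
lra.
Qed.

End gradient_theory.

(** * Descent and cocoercivity for smooth convex functions *)

Section smooth.
Context {R : realType} {n : nat} (L : R) (f : 'rV[R]_n -> R).
Hypotheses (L_gt0 : 0 < L) (f_smooth : smooth_convex L f).

Lemma smooth_sqr x y :
  dot (gradient f x - gradient f y) (gradient f x - gradient f y) <=
  L ^+ 2 * dot (x - y) (x - y).
Proof.
have [_ _ /(_ x y) lip] := f_smooth.
rewrite -!norm2_sqr -exprMn ler_sqr ?nnegrE ?norm2_ge0 //.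
by rewrite mulr_ge0 ?norm2_ge0 ?ltW.
Qed.

(* Summing the gradient inequality over a subdivision of [x, y] replaces the
   integral of the gradient along the segment. *)
Lemma smooth_descent x y :
  f y <= f x + dot (gradient f x) (y - x) + L / 2 * dot (y - x) (y - x).
Proof.
have [cf df _] := f_smooth.
set d := y - x; move AE : (dot _ d) => A; move DE : (dot d d) => D.
pose p (h : R) m := x + (m%:R * h) *: d.
(* The gradient at the [j]-th node differs from that at [x] by at most [L j h |d|]; summing [j] up
   to [m] gives [m (m + 1) / 2]. *)
have step (h : R) m : 0 < h ->
    f (p h m) <= f x + m%:R * h * A + L * h ^+ 2 * D * (m%:R * m.+1%:R / 2).
  move=> h0; elim: m => [|m ih]; first by rewrite /p !mul0r scale0r mulr0 !addr0.
  have := convex_ge_gradient _ (p h m.+1) (p h m) cf (df _).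
  have := smooth_sqr (p h m.+1) x.
  move: (gradient f (p h m.+1)) => g.
  have -> : p h m.+1 - x = (m.+1%:R * h) *: d by rewrite /p addrAC subrr add0r.
  have -> : p h m - p h m.+1 = - h *: d.
    by rewrite /p opprD addrACA subrr add0r -scalerBl; congr (_ *: _); lra.
  rewrite !dotZl !dotZr DE => s1 s3.
  have c0 : 0 < L * (m.+1%:R * h) by rewrite !mulr_gt0.
  have := dot_le_of_sqr _ (g - gradient f x) d c0.
  rewrite (dotDl g _ d) (dotNl _ d) AE DE.
  have /[swap]/[apply] s2 : dot (g - gradient f x) (g - gradient f x) <=
      (L * (m.+1%:R * h)) ^+ 2 * D.
    by move: (m.+1%:R * h) s1 => c /le_trans; apply; rewrite exprMn; lra.
  move: (dot g d) (f (p h m)) (f (p h m.+1)) ih s2 s3 => G F F' ih s2 s3.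
  have s4 : h * G <= h * (A + L * (m.+1%:R * h) * D) by rewrite ler_pM2l //; lra.
  move: ih s3 s4; rewrite -(natr1 m.+1) -(natr1 m); move: (m%:R : R) => M; lra.
suff : f y - (f x + A + L / 2 * D) <= 0 by rewrite subr_le0.
(* With [N + 1] pieces of length [1 / (N + 1)] the quadratic term is
   [L / 2 * D * (1 + 1 / (N + 1))], so only the last fraction is in excess. *)
apply: (@le0_of_le_invS R _ (L / 2 * D)) => N.
have N0 : (0 : R) < N.+1%:R by [].
have := step N.+1%:R^-1 N.+1; rewrite invr_gt0 => /(_ N0).
have -> : p N.+1%:R^-1 N.+1 = y.
  by rewrite /p divff ?gt_eqF // scale1r addrC subrK.
rewrite divff ?gt_eqF // mul1r.
rewrite -(natr1 N.+1).
set M := (N.+1%:R : R).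
have -> : L * M^-1 ^+ 2 * D * (M * (M + 1) / 2) = L / 2 * D * (1 + M^-1).
  by field; rewrite gt_eqF.
move: (f y) => F.
move: (M^-1) => M1; lra.
Qed.

(** Evaluate [f] at [y - r / L], with [r] the gradient difference: convexity at [x] bounds it below,
    descent from [y] bounds it above. This point minimises the quadratic upper model at [y] minus
    the linear form of the gradient at [x]. *)
Lemma smooth_cocoercive x y :
  f x + dot (gradient f x) (y - x) +
    (2 * L)^-1 * dot (gradient f y - gradient f x) (gradient f y - gradient f x)
  <= f y.
Proof.
have [cf df _] := f_smooth.
move: (smooth_descent y) (fun w => convex_ge_gradient _ x w cf (df x)).
move: (gradient f y) (gradient f x) => gy gx descent lower.
pose r := gy - gx.
have rr : dot gy r = dot gx r + dot r r by rewrite -dotDl addrC subrK.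
have := lower (y - L^-1 *: r).
have := descent (y - L^-1 *: r).
have -> : y - L^-1 *: r - y = - (L^-1 *: r) by rewrite addrAC subrr add0r.
have -> : y - L^-1 *: r - x = (y - x) - L^-1 *: r by rewrite addrAC.
rewrite (dotDr _ (y - x)) !dotNr !dotNl !dotZr !dotZl rr -/r.
move: (f (y - _)) (f y) (f x) (dot r r) (dot _ r) (dot _ (y - x))
  => Fw Fy Fx D B A.
have -> : L / 2 * - - (L^-1 * (L^-1 * D)) = (2 * L)^-1 * D.
  by field; rewrite gt_eqF.
have -> : (2 * L)^-1 = L^-1 / 2 by rewrite invfM mulrC.
move: L^-1 => M; lra.
Qed.

End smooth.

(** * Continuity and subgradients of finite convex functions *)

Section convex_theory.
Context {R : realType} {n : nat} (phi : 'rV[R]_n -> R).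
Hypothesis phi_convex : convex phi.
Implicit Types (x y z g h : 'rV[R]_n).

(** Induction on the coordinates: [c_i e_i + S] is the midpoint of [2 c_i e_i] and [2 S], so the
    radius doubles at each stage, and [2 c_i e_i] lies between the two points [2 r e_i] and
    [- 2 r e_i]. *)
Lemma convex_le_sum (s : seq 'I_n) (r : R) : 0 < r ->
  exists M, forall c : 'I_n -> R, (forall i, `|c i| <= r) ->
    phi (\sum_(i <- s) c i *: delta_mx 0 i) <= M.
Proof.
elim: s r => [|i s ih] r r0; first by exists (phi 0) => c _; rewrite big_nil.
have [M1 M1P] := ih (2 * r) (mulr_gt0 (ltr0n _ 2) r0).
pose e : 'rV[R]_n := delta_mx 0 i; pose a := phi ((2 * r) *: e).
pose b := phi (- (2 * r) *: e).
exists ((`|a| + `|b| + M1) / 2) => c cr; rewrite big_cons.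
set S := \sum_(j <- s) _.
have S2 : phi (2 *: S) <= M1.
  rewrite scaler_sumr; under eq_bigr do rewrite scalerA.
  by apply: M1P => j; rewrite normrM ger0_norm // ler_pM2l.
have ci : phi ((2 * c i) *: e) <= `|a| + `|b|.
  pose t := (c i + r) / (2 * r).
  have /andP[cr1 cr2] : - r <= c i <= r by rewrite -ler_norml.
  have t01 : 0 <= t <= 1.
    by rewrite divr_ge0 /=; [rewrite ler_pdivrMr; lra|lra|lra].
  have := convex_le _ ((2 * r) *: e) (- (2 * r) *: e) _ phi_convex t01.
  rewrite !scalerA -scalerDl -/a -/b.
  have -> : t * (2 * r) + (1 - t) * - (2 * r) = 2 * c i.
    by rewrite /t; field; rewrite gt_eqF.
  move=> /le_trans; apply; have := ler_norm a; have := ler_norm b.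
  have := normr_ge0 a; have := normr_ge0 b; clearbody a b t; move: t01.
  by move: `|a| `|b| => a' b'; nra.
have [t tE] : exists t : R, 2 * t = 1 by exists 2^-1; rewrite mulfV ?pnatr_eq0.
have t01 : 0 <= t <= 1 by apply/andP; split; lra.
have := convex_le _ ((2 * c i) *: e) (2 *: S) _ phi_convex t01.
have -> : 1 - t = t by lra.
rewrite !scalerA mulrA (mulrC t) tE mul1r scale1r.
move: (phi _) (phi _) (phi _) S2 ci => p q w; nra.
Qed.

Lemma convex_le_ball (r : R) : exists M, forall x, `|x| <= r -> phi x <= M.
Proof.
have r0 : 0 < `|r| + 1 by rewrite ltr_wpDl.
have [M MP] := convex_le_sum (index_enum 'I_n) _ r0.
exists M => x xr; rewrite [x]row_sum_delta; apply: MP => i.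
by rewrite (le_trans (normr_coord_le _ _)) // (le_trans xr) // ler_wpDr // ler_norm.
Qed.

(** An upper bound [M] near [x] suffices. For [y = x + t h] with [|h| <= 1], [y] lies between [x]
    and [x + h], and [x] between [x - h] and [y] with weight [t / (1 + t)]; both give
    [|phi y - phi x| <= t (M - phi x)]. *)
Lemma convex_continuous : continuous phi.
Proof.
move=> x; have [M MP] := convex_le_ball (`|x| + 1).
apply/(@cvgrPdist_le _ R^o _ (nbhs x)) => e e0.
have c0 : 0 < `|M - phi x| + 1 by rewrite ltr_wpDl.
have [t [t0 t1]] := exists_lt2 _ _ (@ltr01 R) (divr_gt0 e0 c0).
rewrite ltr_pdivlMr // => te.
apply/nbhs_ballP; exists t => //= y; rewrite -ball_normE /= => yt.
pose h := t^-1 *: (y - x).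
have h1 : `|h| <= 1.
  by rewrite normrZ gtr0_norm ?invr_gt0 // ler_pdivrMl // mulr1 distrC ltW.
have Mp : phi (x + h) <= M.
  by apply: MP; rewrite (le_trans (ler_normD _ _)) // lerD2l.
have Mm : phi (x - h) <= M.
  by apply: MP; rewrite (le_trans (ler_normB _ _)) // lerD2l.
have yE : y = x + t *: h by rewrite scalerA divff ?gt_eqF // scale1r addrC subrK.
clearbody h.
have t01 : 0 <= t <= 1 by rewrite !ltW.
have t10 : 0 < 1 + t by lra.
pose s := t / (1 + t).
have s01 : 0 <= s <= 1 by rewrite divr_ge0 ?ler_pdivrMr //=; lra.
have := convex_le _ (x - h) y _ phi_convex s01.
have := convex_le _ (x + h) x _ phi_convex t01.
have -> : t *: (x + h) + (1 - t) *: x = y.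
  by rewrite yE; apply/rowP => i; rewrite !mxE; ring.
have -> : s *: (x - h) + (1 - s) *: y = x.
  by rewrite yE /s; apply/rowP => i; rewrite !mxE; field; rewrite gt_eqF.
move: (phi (x - h)) (phi (x + h)) (phi x) (phi y) Mp Mm te
  => a b p q bM aM te up lo.
have {}lo : (1 + t) * p <= t * a + q.
  have := ler_wpM2l (ltW t10) lo.
  have -> : (1 + t) * (s * a + (1 - s) * q) = t * a + q; last by [].
  by rewrite /s; field; rewrite gt_eqF.
have := ler_norm (M - p); have := normr_ge0 (M - p).
move: `|M - p| te => m te m0 mp.
by rewrite ler_norml; apply/andP; split; nra.
Qed.

Lemma continuous_min_ball (f : 'rV[R]_n -> R) x (r : R) : continuous f -> 0 <= r ->
  exists2 y, `|y - x| <= r & forall z, `|z - x| <= r -> f y <= f z.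
Proof.
move=> cf r0; pose A := [set y : 'rV[R]_n | `|y - x| <= r].
have [|||y yA yP] := @EVT_min_rV R n f A.
- by exists x; rewrite /A /= subrr normr0.
- apply: bounded_closed_compact.
    exists (`|x| + r); split; first exact: num_real.
    move=> M xM y /= yr; rewrite (le_trans _ (ltW xM)) //.
    by rewrite -[y](subrK x) addrC (le_trans (ler_normD _ _)) // lerD2l.
  have -> : A = closed_ball_ Num.norm x r.
    by apply/seteqP; split=> y; rewrite /A /closed_ball_ /= distrC.
  exact: closed_closed_ball_.
- exact: continuous_subspaceT.
exists y; first by rewrite inE in yA.
by move=> z zr; apply: yP; rewrite inE.
Qed.

(* For K large a minimiser of phi + K |.|^2 on the unit ball is interior, and
   then - 2 K x is a subgradient at x. *)
Lemma exists_subgradient : exists x g, subdifferential phi x g.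
Proof.
have cphi := convex_continuous.
have [y0 _ y0P] := continuous_min_ball phi 0 1 cphi ler01.
(* [K] exceeds the drop of [phi] from [0] to its minimum on the ball, so a point with [|x| = 1]
   would have a larger penalised value than [0]. *)
pose K := `|phi 0 - phi y0| + 1.
have K0 : 0 < K by rewrite ltr_wpDl.
have KP : phi 0 - phi y0 < K by rewrite (le_lt_trans (ler_norm _)) // ltrDl.
clearbody K.
have cpsi : continuous (fun u : 'rV[R]_n => phi u + K * dot u u).
  have cdot : continuous (fun u : 'rV[R]_n => dot u u).
    by apply: (@continuous_dot R n id id) => v; exact: cvg_id.
  by move=> u; exact: (cvgD (cphi u) (cvgM (@cst_continuous _ _ K _) (cdot u))).
have [x x1 xP] := continuous_min_ball _ 0 1 cpsi ler01.
rewrite subr0 in x1.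
have {}x1 : `|x| < 1.
  rewrite lt_neqAle x1 andbT; apply/eqP => x1E.
  have := xP 0; rewrite subrr normr0 ler01 => /(_ isT).
  have := y0P x; rewrite subr0 x1E lexx => /(_ isT).
  have := normr_sqr_le_dot x; rewrite x1E expr1n.
  have -> : dot (0 : 'rV[R]_n) 0 = 0.
    by rewrite /dot big1 // => i _; rewrite mxE mul0r.
  move: KP; move: (phi 0) (phi x) (phi y0) (dot x x).
  by move=> a b c d; nra.
exists x, (- (2 * K) *: x) => y; rewrite -subr_le0.
move dE : (y - x) => d.
have d0 : 0 < `|d| + 1 by rewrite ltr_wpDl.
have r0 : 0 < Num.min 1 ((1 - `|x|) / (`|d| + 1)).
  by rewrite lt_min ltr01 divr_gt0 // subr_gt0.
(* For small [t] the point [x + t d] stays in the ball; minimality and convexity, divided by [t],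
   leave an error [K t |d|^2]. *)
apply: (@le0_of_le_small R _ (K * dot d d) _ r0) => t /andP[t0].
rewrite lt_min ltr_pdivlMr // => /andP[t1 tx].
have xtd : `|x + t *: d| <= 1.
  rewrite (le_trans (ler_normD _ _)) // normrZ gtr0_norm //.
  by move: tx; move: `|d| `|x| => D X; lra.
have := xP (x + t *: d); rewrite subr0 => /(_ xtd).
have t01 : 0 <= t <= 1 by rewrite !ltW.
have := convex_le _ y x _ phi_convex t01.
have -> : t *: y + (1 - t) *: x = x + t *: d.
  by rewrite -dE; apply/rowP => i; rewrite !mxE; ring.
rewrite !dotDl !dotDr !dotZl !dotZr (dotC d x) => h1 h2.
rewrite -(ler_pM2l t0).
move: (phi (x + _)) (phi x) (phi y) (dot x x) (dot x d) (dot d d) h1 h2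
  => p q s a b c.
lra.
Qed.

End convex_theory.

(** * Differentiability and smoothness of the conjugate *)

Section conjugate_theory.
Context {R : realType} {n : nat} (sigma : R) (phi : 'rV[R]_n -> R).
Hypotheses (sigma_gt0 : 0 < sigma) (phi_strong : strongly_convex sigma phi).
Implicit Types (x y z w g : 'rV[R]_n).

Lemma strongly_convex_ge x y g : subdifferential phi x g ->
  phi x + dot g (y - x) + sigma / 2 * dot (y - x) (y - x) <= phi y.
Proof.
move=> xg; have [_ /(_ x y g xg)] := phi_strong; rewrite norm2_sqr.
by move: (sigma / 2 * _) (phi x) (phi y) (dot g _) => a b c d; lra.
Qed.

Lemma subdifferential_surj z : exists x, subdifferential phi x z.
Proof.
have [cphi _] := phi_strong.
have [x0 [g0 g0P]] := exists_subgradient _ cphi.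
pose psi y := phi y - dot z y.
have cpsi : continuous psi.
  have cdot : continuous (dot z : 'rV[R]_n -> R).
    apply: (@continuous_dot R n (fun=> z) id) => v; last exact: cvg_id.
    by apply: cst_continuous.
  by move=> u; exact: (cvgB (convex_continuous _ cphi u) (cdot u)).
have s2 : 0 < sigma / 2 by rewrite divr_gt0.
(* Beyond radius [Q + 1] the squared distance is at least [Q], so Cauchy-Schwarz bounds
   [<z - g0, y - x0>] by the strong convexity term. The [+ 1] allows passing from a distance to its
   square. *)
pose Q := dot (z - g0) (z - g0) / (sigma / 2) ^+ 2.
have Q0 : 0 <= Q by rewrite divr_ge0 ?dot_ge0 ?sqr_ge0.
have r0 : 0 <= Q + 1 by rewrite ltW // ltr_wpDl.
have far y : Q + 1 < `|y - x0| -> psi x0 <= psi y.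
  move=> yr; have yd := normr_sqr_le_dot (y - x0).
  have := strongly_convex_ge _ y _ g0P.
  have : dot (z - g0) (z - g0) <= (sigma / 2) ^+ 2 * dot (y - x0) (y - x0).
    rewrite mulrC -ler_pdivrMr ?exprn_gt0 // -/Q (le_trans _ yd) //.
    by move: yr; move: `|y - x0| => u; nra.
  move=> /(dot_le_of_sqr _ _ _ s2).
  rewrite dotDl dotNl /psi.
  have -> : dot z (y - x0) = dot z y - dot z x0 by rewrite dotDr dotNr.
  move: (phi y) (phi x0) (dot z y) (dot z x0) (dot g0 _) (sigma / 2 * _).
  by move=> a b c d e k; lra.
have [x xr xP] := continuous_min_ball _ x0 _ cpsi r0.
exists x => y.
have psi_le : psi x <= psi y.
  have [/xP//|/far] := leP `|y - x0| (Q + 1); apply: le_trans.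
  by apply: xP; rewrite subrr normr0.
move: psi_le; rewrite /psi dotDr dotNr.
move: (phi y) (phi x) (dot z y) (dot z x) => a b c d; lra.
Qed.

(** Equality case of Fenchel-Young: the subgradient inequality says that [x] attains the
    supremum. *)
Lemma conjugate_subdifferential x z : subdifferential phi x z ->
  conjugate phi z = dot z x - phi x.
Proof.
move=> zx; rewrite /conjugate.
suff -> : econjugate phi z = (dot z x - phi x)%:E by [].
apply/eqP; rewrite eq_le; apply/andP; split.
  apply/ereal_supP => _ [y _ <-]; rewrite lee_fin.
  have := zx y; rewrite dotDr dotNr.
  move: (phi y) (phi x) (dot z y) (dot z x) => a b c d; lra.
by apply: le_ereal_sup_tmp; exists (dot z x - phi x)%:E => //; exists x.
Qed.

Lemma conjugate_ge_subdifferential x z w : subdifferential phi x z ->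
  conjugate phi z + dot (w - z) x <= conjugate phi w.
Proof.
move=> zx; have [y wy] := subdifferential_surj w.
rewrite (conjugate_subdifferential _ _ zx) (conjugate_subdifferential _ _ wy).
have := wy x; rewrite dotDr dotNr dotDl dotNl.
move: (phi y) (phi x) (dot z x) (dot w x) (dot w y) => a b c d e; lra.
Qed.

(** Strong convexity of [phi] dualises to smoothness of its conjugate: the growth
    [sigma / 2 |y - x|^2] absorbs [<w - z, y - x>] up to [|w - z|^2 / (2 sigma)]. *)
Lemma conjugate_le_subdifferential x z w : subdifferential phi x z ->
  conjugate phi w <=
    conjugate phi z + dot (w - z) x + (2 * sigma)^-1 * dot (w - z) (w - z).
Proof.
move=> zx; have [y wy] := subdifferential_surj w.
rewrite (conjugate_subdifferential _ _ zx) (conjugate_subdifferential _ _ wy).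
have := strongly_convex_ge _ y _ zx.
(* This square yields the Young inequality [h3]. *)
have := dot_ge0 (w - z - sigma *: (y - x)).
move vE : (w - z) => v; move uE : (y - x) => u.
rewrite !dotDl !dotDr !dotNl !dotNr !dotZl !dotZr (dotC u v).
have -> : dot w y = dot z y + dot v y by rewrite -dotDl -vE addrC subrK.
have -> : dot z y = dot z x + dot z u by rewrite -dotDr -uE addrC subrK.
have -> : dot v y = dot v x + dot v u by rewrite -dotDr -uE addrC subrK.
move: (dot z x) (dot z u) (dot v x) (dot v u) (dot u u) (dot v v) (phi x) (phi y).
move=> a b c d e k p q h1 h2.
have h3 : d <= sigma / 2 * e + (2 * sigma)^-1 * k.
  rewrite -(ler_pM2l sigma_gt0).
  have -> : sigma * (sigma / 2 * e + (2 * sigma)^-1 * k) = sigma ^+ 2 / 2 * e + k / 2.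
    by field; rewrite gt_eqF.
  nra.
move: ((2 * sigma)^-1 * k) h3 => m; lra.
Qed.

(** The lower and upper bounds enclose the first-order error between [0] and a quadratic. *)
Lemma gradient_conjugate x z : subdifferential phi x z ->
  gradient (conjugate phi) z = x.
Proof.
move=> zx; apply: (gradient_unique _ _ _ (2 * sigma)^-1) => w.
have := conjugate_ge_subdifferential _ _ w zx.
have := conjugate_le_subdifferential _ _ w zx.
rewrite (dotC x); move: (_ * _) (conjugate phi _) (conjugate phi _) (dot _ x).
by move=> a b c d h1 h2; rewrite ler_norml; apply/andP; split; lra.
Qed.

Lemma conjugate_ge z w :
  conjugate phi z + dot (w - z) (gradient (conjugate phi) z) <= conjugate phi w.
Proof.
have [x zx] := subdifferential_surj z.
by rewrite (gradient_conjugate _ _ zx) conjugate_ge_subdifferential.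
Qed.

Lemma conjugate_le z w :
  conjugate phi w <= conjugate phi z + dot (w - z) (gradient (conjugate phi) z)
    + (2 * sigma)^-1 * dot (w - z) (w - z).
Proof.
have [x zx] := subdifferential_surj z.
by rewrite (gradient_conjugate _ _ zx) conjugate_le_subdifferential.
Qed.

End conjugate_theory.

(** * Scalar inequalities: the cubic rate and one energy step *)

Section decrease.
Context {R : realType}.

(* Between h = k/2 and k the energy drops by at least c (k/2)^2 m_k (k/2), while
   E_h - E_k tends to 0. *)
Lemma le_inv_cube_of_decrease (E G m : nat -> R) (c : R) : 0 < c ->
    (forall k, 0 <= E k) -> (forall k, 0 <= G k) ->
    (forall k, E k.+1 + c * k.+1%:R ^+ 2 * G k <= E k) ->
    (forall k i, (i < k.+1)%N -> m k <= G i) -> (forall k, 0 <= m k) ->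
  forall e, 0 < e -> exists N, forall k, (N <= k)%N -> m k <= e * (1 / k%:R ^+ 3).
Proof.
move=> c0 E0 G0 dec mG m0 e e0.
(* Each step from index [h] on loses at least [c (h + 1)^2 m k], since [m k] bounds every [G i] with
   [i <= k] from below. *)
have drop h j k : (h + j <= k)%N ->
    E (h + j)%N + j%:R * (c * h.+1%:R ^+ 2 * m k) <= E h.
  elim: j => [|j ih] hjk; first by rewrite addn0 mul0r addr0.
  rewrite addnS in hjk; have {}ih := ih (ltnW hjk).
  apply: le_trans ih; rewrite addnS.
  have lehm : c * h.+1%:R ^+ 2 * m k <= c * (h + j).+1%:R ^+ 2 * G (h + j)%N.
    rewrite -mulrA -[leRHS]mulrA (ler_pM2l c0); apply: ler_pM => //.
      by rewrite lerXn2r ?nnegrE // ler_nat ltnS leq_addr.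
    by apply: mG; rewrite ltnW.
  rewrite -(natr1 j) mulrDl mul1r; move: lehm (dec (h + j)%N).
  move: (c * _ * m k) (c * _ * G _) (E _) (E _) => a b p q; lra.
have Emono h k : (h <= k)%N -> E k <= E h.
  move=> /subnKC <-; apply: le_trans (drop h (k - h)%N (h + (k - h))%N (leqnn _)).
  by rewrite lerDl !mulr_ge0 ?exprn_ge0 // ltW.
have hinf : has_inf (range E).
  by split; [exists (E 0%N), 0%N | exists 0 => _ [k _ <-]].
(* The infimum of [E] serves as its limit; the [8] comes from [(k / 2)^3]. *)
have ec : 0 < e * c / 8 by rewrite divr_gt0 ?mulr_gt0.
have [_ [N _ <-] EN] := inf_adherent ec hinf.
exists (2 * N).+2 => k Nk.
have k0 : (0 : R) < k%:R by rewrite ltr0n (leq_trans _ Nk).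
have hN : (N <= k./2)%N by lia.
have hk : (k./2 <= k)%N by lia.
have drp := drop k./2 (k - k./2)%N k; rewrite subnKC // leqnn in drp.
have {}drp := drp isT.
have k1 : k%:R / 2 <= k./2.+1%:R :> R.
  rewrite ler_pdivrMr // -natrM ler_nat; lia.
have k2 : k%:R / 2 <= (k - k./2)%:R :> R.
  rewrite ler_pdivrMr // -natrM ler_nat; lia.
have infE : inf (range E) <= E k by apply: ge_inf; [case: hinf|exists k].
have Eh := Emono _ _ hN.
have main : k%:R / 2 * (c * (k%:R / 2) ^+ 2 * m k) <= e * c / 8.
  apply: (@le_trans _ _ ((k - k./2)%:R * (c * k./2.+1%:R ^+ 2 * m k))).
    have k20 : (0 : R) <= k%:R / 2 by rewrite divr_ge0 // ltW.
    apply: ler_pM => //; first by rewrite !mulr_ge0 ?exprn_ge0 // ltW.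
    by rewrite ler_wpM2r // ler_pM2l // lerXn2r ?nnegrE.
  move: drp EN infE Eh.
  move: (E k) (E N) (E _) (inf _) (_ * (_ * _)) => a b d i p; lra.
rewrite mul1r ler_pdivlMr ?exprn_gt0 // -(ler_pM2l c0).
move: main; move: (m k) (k%:R : R) => u v; lra.
Qed.

(* P, Q, W, H are the inner products of the gradient at x_{k+1} with x_{k+1},
   x_k, x^*, and the gradient at x_k. *)
Lemma energy_step (sigma s c F F' Fs G G' H P Q W Y V V' : R) :
    0 < sigma -> 0 < s -> 0 < c ->
    2 * Y = (c + 2) * P - c * (Q - s * H) ->
    F' + (W - P) + s / 2 * G' <= Fs ->
    F' + (Q - P) + s / 2 * (G - 2 * H + G') <= F ->
    V' <= V - sigma * s * ((c + 1) / 2) * (Y - W)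
         + (2 * sigma)^-1 * ((sigma * s * ((c + 1) / 2)) ^+ 2 * G') ->
  (c + 1) * (c + 2) * sigma * s * (F' - Fs) + 4 * V' +
    sigma * s ^+ 2 * (c + 1) / 2 * (c * G + G') <=
  c * (c + 1) * sigma * s * (F - Fs) + 4 * V.
Proof.
move=> sigma0 s0 c0 YE h1 h2.
have -> : (2 * sigma)^-1 * ((sigma * s * ((c + 1) / 2)) ^+ 2 * G') =
    sigma * s ^+ 2 * (c + 1) ^+ 2 / 8 * G' by field; rewrite gt_eqF.
have {}YE : Y = ((c + 2) * P - c * (Q - s * H)) / 2 by lra.
rewrite {}YE => h3.
have ss : 0 < sigma * s by rewrite mulr_gt0.
have c1 : 0 < c + 1 by lra.
(* With the multipliers [l1] for [h1] and [l2] for [h2], the terms in [P], [Q], [W] and [H] cancel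
   and the claim is their sum with [4] times [h3]. *)
have l1 : 0 < 2 * (sigma * s) * (c + 1) by rewrite !mulr_gt0.
have l2 : 0 < sigma * s * (c * (c + 1)) by rewrite !mulr_gt0.
move: h1; rewrite -(ler_pM2l l1) => h1.
move: h2; rewrite -(ler_pM2l l2) => h2.
lra.
Qed.

End decrease.

(** A gradient step of length [1 / L] from the minimiser would lower [f] by at least
    [|g|^2 / (2 L)]. *)
Lemma smooth_gradient_min_eq0 (R : realType) (n : nat) (L : R)
    (f : 'rV[R]_n -> R) (xstar : 'rV[R]_n) :
  0 < L -> smooth_convex L f -> (forall y, f xstar <= f y) ->
  gradient f xstar = 0.
Proof.
move=> L0 sf xmin; have := smooth_descent L f L0 sf xstar.
move: (gradient f xstar) => g /(_ (xstar - L^-1 *: g)).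
have -> : xstar - L^-1 *: g - xstar = - (L^-1 *: g) by rewrite addrAC subrr add0r.
move=> /(le_trans (xmin _)); rewrite !dotNr !dotNl !dotZr !dotZl opprK.
have -> : L / 2 * (L^-1 * (L^-1 * dot g g)) = L^-1 / 2 * dot g g.
  by field; rewrite gt_eqF.
move=> h; have Li : 0 < L^-1 by rewrite invr_gt0.
have := dot_ge0 g; have := normr_sqr_le_dot g.
move: (dot g g) h => D h ng D0.
have D0' : D <= 0 by rewrite -(ler_pM2l Li); move: (L^-1) (f _) h => c F; nra.
apply/eqP; rewrite -normr_eq0 -sqrf_eq0; apply/eqP/le_anti.
by rewrite sqr_ge0 (le_trans ng D0').
Qed.

(** Reduces the energy loss to a single squared gradient with quadratic weight, the form used for
    the cubic rate. *)
Lemma sqr_weight_le (R : realType) (p c a b : R) :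
  0 < p -> 0 <= c -> 0 <= a -> 0 <= b ->
  p / 2 * c ^+ 2 * a <= p * (c + 1) / 2 * (c * a + b).
Proof.
move=> p0 k0 a0 b0; rewrite -subr_ge0.
have -> : p * (c + 1) / 2 * (c * a + b) - p / 2 * c ^+ 2 * a =
  p / 2 * (c * a + (c + 1) * b) by field.
apply: mulr_ge0; first by rewrite divr_ge0 // ltW.
by apply: addr_ge0; apply: mulr_ge0 => //; apply: addr_ge0.
Qed.

(** Pairing the recursion for [X'] with [g'] turns it into the scalar relation of [energy_step]. *)
Lemma energy_step_dot (R : realType) (n : nat) (sigma s c F F' Fs V V' : R)
    (X X' xs y g g' : 'rV[R]_n) :
  0 < sigma -> 0 < s -> 0 < c ->
  (c + 2) *: X' = 2 *: y + c *: (X - s *: g) ->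
  F' + dot g' (xs - X') + s / 2 * dot g' g' <= Fs ->
  F' + dot g' (X - X') + s / 2 * dot (g - g') (g - g') <= F ->
  V' <= V + dot (- (sigma * s * ((c + 1) / 2)) *: g') y
        - dot (- (sigma * s * ((c + 1) / 2)) *: g') xs
        + (2 * sigma)^-1 * dot (- (sigma * s * ((c + 1) / 2)) *: g')
                               (- (sigma * s * ((c + 1) / 2)) *: g') ->
  (c + 1) * (c + 2) * sigma * s * (F' - Fs) + 4 * V' +
    sigma * s ^+ 2 * (c + 1) / 2 * (c * dot g g + dot g' g') <=
  c * (c + 1) * sigma * s * (F - Fs) + 4 * V.
Proof.
move=> sigma0 s0 c0 /(congr1 (dot g')).
rewrite !dotE (dotC g g') => Y i1 i2 i3.
apply: (energy_step sigma s c F F' Fs (dot g g) (dot g' g') (dot g' g)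
  (dot g' X') (dot g' X) (dot g' xs) (dot g' y) V V') => //.
- by move: Y; lra.
- by move: i2; lra.
by move: i3; lra.
Qed.

(** * Decrease of the energy along the iteration *)

Section accelerated.
Context {R : realType} {n : nat} {L sigma s : R}.
Context {f phi : 'rV[R]_n -> R} {xstar zstar : 'rV[R]_n} {x z : nat -> 'rV[R]_n}.
Hypotheses (L_gt0 : 0 < L) (f_smooth : smooth_convex L f).
Hypothesis xstar_min : forall y, f xstar <= f y.
Hypotheses (sigma_gt0 : 0 < sigma) (phi_strong : strongly_convex sigma phi).
Hypothesis zstarE : gradient (conjugate phi) zstar = xstar.
Hypotheses (s_gt0 : 0 < s) (s_le : s <= 1 / L).
Hypothesis z_rec : forall k : nat,
  z k.+1 - z k = - (sigma * s * (k.+1%:R / 2)) *: gradient f (x k).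
Hypothesis x_rec : forall k : nat,
  k.+3%:R *: x k.+1 = 2 *: gradient (conjugate phi) (z k.+1)
                      + k.+1%:R *: (x k - s *: gradient f (x k)).

Lemma smooth_cocoercive_step u v :
  f u + dot (gradient f u) (v - u) + s / 2 *
    dot (gradient f v - gradient f u) (gradient f v - gradient f u) <= f v.
Proof.
apply: le_trans (smooth_cocoercive L f L_gt0 f_smooth u v).
rewrite lerD2l ler_wpM2r ?dot_ge0 // ler_pdivrMr // (le_trans s_le) //.
by rewrite invfM mulrAC mulVf ?pnatr_eq0.
Qed.

Lemma bregman_zstarE w : bregman (conjugate phi) w zstar =
  conjugate phi w - conjugate phi zstar - dot (w - zstar) xstar.
Proof. by rewrite /bregman zstarE. Qed.

Lemma bregman_ge0 k : 0 <= bregman (conjugate phi) (z k) zstar.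
Proof.
rewrite /bregman; have := conjugate_ge sigma phi sigma_gt0 phi_strong zstar (z k).
move: (dot _ _) (conjugate phi _) (conjugate phi _) => a b c; lra.
Qed.

Definition energy k : R :=
  k.+1%:R * k.+2%:R * sigma * s * (f (x k) - f xstar)
  + 4 * bregman (conjugate phi) (z k.+1) zstar.

Lemma energy_ge0 k : 0 <= energy k.
Proof. by rewrite addr_ge0 ?mulr_ge0 ?bregman_ge0 ?subr_ge0 // ltW. Qed.

(** Both divergences have base point [zstar], so their difference is the increment of the conjugate
    minus [<v, xstar>]; the quadratic upper bound controls that increment. *)
Lemma bregman_step w v : bregman (conjugate phi) (w + v) zstar <=
  bregman (conjugate phi) w zstar + dot v (gradient (conjugate phi) w)
  - dot v xstar + (2 * sigma)^-1 * dot v v.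
Proof.
have := conjugate_le sigma phi sigma_gt0 phi_strong w (w + v).
have -> : w + v - w = v by rewrite addrAC subrr add0r.
rewrite !bregman_zstarE; move: (gradient _ w) => y.
rewrite (addrAC w v) (dotDl (w - zstar)).
move: (_ * _) (conjugate phi _) (conjugate phi _) (conjugate phi _) => a b c d.
move: (dot _ _) (dot _ _) (dot _ _) => p q r; lra.
Qed.

Lemma energy_decrease k :
  energy k.+1 + sigma * s ^+ 2 * k.+2%:R / 2 *
    (k.+1%:R * dot (gradient f (x k)) (gradient f (x k))
     + dot (gradient f (x k.+1)) (gradient f (x k.+1)))
  <= energy k.
Proof.
have i1 := smooth_cocoercive_step (x k.+1) xstar.
rewrite (smooth_gradient_min_eq0 R n L f xstar) // sub0r dotNl dotNr opprK in i1.
have i2 := smooth_cocoercive_step (x k.+1) (x k).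
have zE : z k.+2 = z k.+1 + - (sigma * s * (k.+2%:R / 2)) *: gradient f (x k.+1).
  by rewrite -z_rec addrC subrK.
have := bregman_step (z k.+1)
  (- (sigma * s * (k.+2%:R / 2)) *: gradient f (x k.+1)).
rewrite -zE => i3.
(* The scalar step is taken with [c = k + 1], so [k + 2] and [k + 3] become [c + 1] and [c + 2]. *)
have c0 : (0 : R) < k.+1%:R by [].
have xE := x_rec k.
have e2 : k.+2%:R = k.+1%:R + 1 :> R by rewrite natr1.
have e3 : k.+3%:R = k.+1%:R + 2 :> R by rewrite -natrD addn2.
rewrite e2 in i3; rewrite e3 in xE; rewrite /energy e2 e3.
exact: (energy_step_dot _ _ _ _ _ _ _ _ _ _ _ _ _ _ _ _
  sigma_gt0 s_gt0 c0 xE i1 i2 i3).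
Qed.

End accelerated.

Theorem corollary4 (R : realType) (n : nat) (L sigma s : R)
    (f phi : 'rV[R]_n -> R) (xstar zstar : 'rV[R]_n)
    (x z : nat -> 'rV[R]_n)
    (L_gt0 : 0 < L) (f_smooth : smooth_convex L f)
    (xstar_min : forall y, f xstar <= f y)
    (sigma_gt0 : 0 < sigma) (phi_strong : strongly_convex sigma phi)
    (zstarE : gradient (conjugate phi) zstar = xstar)
    (s_gt0 : 0 < s) (s_le : s <= 1 / L)
    (z_rec : forall k : nat,
      z k.+1 - z k = - (sigma * s * (k.+1%:R / 2)) *: gradient f (x k))
    (x_rec : forall k : nat,
      k.+3%:R *: x k.+1 =
        2 *: gradient (conjugate phi) (z k.+1)
        + k.+1%:R *: (x k - s *: gradient f (x k))) :
  (forall k : nat,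
    f (x k) - f xstar <=
      (2 * sigma * s * (f (x 0%N) - f xstar)
       + 4 * bregman (conjugate phi) (z 1%N) zstar)
      / (k.+1%:R * k.+2%:R * sigma * s))
  /\
  ((fun k : nat => \big[Num.min/norm2 (gradient f (x 0%N)) ^+ 2]_(i < k.+1)
                     norm2 (gradient f (x i)) ^+ 2) : nat -> R)
    =o_\oo ((fun k : nat => 1 / k%:R ^+ 3) : nat -> R).
Proof.
have := energy_decrease L_gt0 f_smooth xstar_min sigma_gt0 phi_strong
  zstarE s_gt0 s_le z_rec x_rec.
have := energy_ge0 (zstar := zstar) (x := x) (z := z) xstar_min sigma_gt0
  phi_strong s_gt0.
set E := energy => E_ge0 dec.
have ss : 0 < sigma * s ^+ 2 by rewrite mulr_gt0 ?exprn_gt0.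
have c0 : 0 < sigma * s ^+ 2 / 2 by rewrite divr_gt0.
have dec' k : E k.+1 + sigma * s ^+ 2 / 2 * k.+1%:R ^+ 2 *
    norm2 (gradient f (x k)) ^+ 2 <= E k.
  apply: le_trans (dec k); rewrite norm2_sqr lerD2l -(natr1 k.+1).
  exact: (sqr_weight_le _ _ _ _ _ ss (ler0n _ _) (dot_ge0 _) (dot_ge0 _)).
split=> [k|].
  have E_le0 : E k <= E 0%N.
    elim: k => // k; apply: le_trans; apply: le_trans (dec' k).
    by rewrite lerDl !mulr_ge0 ?exprn_ge0 ?norm2_ge0 // ltW.
  rewrite ler_pdivlMr ?mulr_gt0 //.
  (* [E 0] is the numerator of the claim; the divergence inside [E k] is nonnegative and is
     dropped. *)
  have := bregman_ge0 sigma_gt0 phi_strong (zstar := zstar) (z := z) k.+1.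
  move: E_le0; rewrite /E /energy.
  move: (f _ - _) (f _ - _) (bregman _ _ _) (bregman _ _ _) => a b p q; lra.
apply/eqoP => e e0.
(* The default value of the iterated minimum is its own term at index [0], so it does not alter the
   minimum. *)
have [||N NP] := le_inv_cube_of_decrease E (fun k => norm2 (gradient f (x k)) ^+ 2)
  (fun k => \big[Num.min/norm2 (gradient f (x 0%N)) ^+ 2]_(i < k.+1)
     norm2 (gradient f (x i)) ^+ 2) _ c0 E_ge0 (fun k => sqr_ge0 _) dec' _ _ e e0.
- by move=> k i ik; apply: (bigmin_le _ (Ordinal ik)).
- by move=> k; apply: le_bigmin => [|i _]; apply: sqr_ge0.
exists N => // k /= Nk.
rewrite !ger0_norm; first exact: NP.
  by rewrite divr_ge0 ?exprn_ge0.
by apply: le_bigmin => [|i _]; apply: sqr_ge0.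
Qed.
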